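(* Let $I \subseteq \mathbb{R}$ be an open interval (more generally, an open set) and let $s \in \mathbb{P}(I)$. If $s$ is strictly positive on $I$, then its positive square-root $\sqrt{s}$ belongs to $\mathbb{P}^{1/2}(I)$.
   Context: All functions are real-valued functions of a real variable $t$; dots denote derivatives with respect to $t$. For an open interval (more generally, open set) $I \subseteq \mathbb{R}$, $\mathbb{P}(I)$ denotes the set of all twice-differentiable functions $s : I \to \mathbb{R}$ satisfying on $I$ the (real) fourth Painlevé equation with both parameters zero, $$\ddot{s} = \frac{1}{2s}\dot{s}^2 + \frac{3}{2}s^3 + 4 t s^2 + 2 t^2 s,$$ where at a zero of $s$ the ratio $\dot{s}^2/(2s)$ is understood as a limit. $\mathbb{P}^{1/2}(I)$ denotes the set of all twice-differentiable functions $\sigma : I \to \mathbb{R}$ satisfying on $I$ the auxiliary equation $$4\ddot{\sigma} = \sigma(3\sigma^2 + 2t)(\sigma^2 + 2t).$$ *)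

(* Defs.v *)
From mathcomp Require Import all_boot all_order all_algebra.
From mathcomp Require Import all_classical all_reals all_analysis.

Set Implicit Arguments.
Unset Strict Implicit.
Unset Printing Implicit Defensive.

Import Order.TTheory GRing.Theory Num.Theory.
Import numFieldNormedType.Exports.

Local Open Scope ring_scope.
Local Open Scope classical_set_scope.

(* A function I -> R on an open set I is represented by any total function
   R -> R extending it: since I is open, the derivatives at points of I, and
   the limits below, do not depend on the values outside I. *)

Definition twice_derivable_on (R : realType) (I : set R) (f : R -> R) : Prop :=
  forall t, I t -> derivable f t 1 /\ derivable f^`()%classic t 1.

(* r is the value at t of the ratio s'^2 / (2 s); at a zero of s, this value is
   the limit of the ratio along the points where it is defined, namely those
   where s does not vanish. If s vanishes identically near t, there are no such
   points and the limit condition is void; s'' (t) = r then forces r = 0 in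
   painleve4, so that the zero function is a solution. *)
Definition ratio_value (R : realType) (s : R -> R) (t r : R) : Prop :=
  let q := fun u : R => s^`()%classic u ^+ 2 / (2 * s u) in
  (s t != 0 -> r = q t) /\
  (s t = 0 -> q u @[u --> within [set u | s u != 0] (nbhs t)] --> r).

Definition painleve4 (R : realType) (I : set R) : set (R -> R) :=
  [set s | twice_derivable_on I s /\
    forall t, I t -> exists2 r, ratio_value s t r &
      s^`(2)%classic t = r + 3 / 2 * s t ^+ 3 + 4 * t * s t ^+ 2 + 2 * t ^+ 2 * s t].

Definition painleve4_half (R : realType) (I : set R) : set (R -> R) :=
  [set sigma | twice_derivable_on I sigma /\
    forall t, I t ->
      4 * sigma^`(2)%classic t =
        sigma t * (3 * sigma t ^+ 2 + 2 * t) * (sigma t ^+ 2 + 2 * t)].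

(* Main.v *)
(** Substituting [s = sigma ^+ 2] turns the singular term [s'^2 / (2 s)] into
    [2 sigma'^2], which cancels against the same term of
    [s'' = 2 sigma'^2 + 2 sigma sigma'']; dividing by [sigma / 2] leaves the
    auxiliary equation. *)
Require Import Defs.
From mathcomp Require Import all_boot all_order all_algebra.
From mathcomp Require Import all_classical all_reals all_analysis.
From mathcomp Require Import ring.

Import Order.TTheory GRing.Theory Num.Theory.
Import numFieldNormedType.Exports.

Set Implicit Arguments.

Local Open Scope ring_scope.
Local Open Scope classical_set_scope.

Lemma is_derive1_sqrt_comp (R : realType) (f : R -> R) (t df : R) :
  0 < f t -> is_derive t 1 f df ->
  is_derive t 1 (fun u => Num.sqrt (f u)) (df / (2 * Num.sqrt (f t))).
Proof.
move=> ft_gt0 fdf; rewrite mulrC.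
by have := is_derive1_sqrt ft_gt0 => ?; exact: is_derive1_comp.
Qed.

(** Quotient rule for [f' / (2 sqrt f)]. Positivity and derivability are asked near [t], since this
    formula for the first derivative must hold on a neighbourhood before it can be differentiated at
    [t]. *)
Lemma is_derive1_sqrt_comp2 (R : realType) (f : R -> R) (t : R) :
  (\forall u \near t, 0 < f u /\ derivable f u 1) ->
  derivable f^`()%classic t 1 ->
  is_derive t 1 (fun u => Num.sqrt (f u))^`()%classic
    (f^`(2)%classic t / (2 * Num.sqrt (f t))
     - f^`()%classic t ^+ 2 / (4 * Num.sqrt (f t) ^+ 3)).
Proof.
move=> f_near /derivableP d2f.
have [ft_gt0 /derivableP d1f] := nbhs_singleton f_near.
have rt_neq0 : Num.sqrt (f t) != 0 by rewrite gt_eqF ?sqrtr_gt0.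
have dr : is_derive t 1 (fun u => 2 * Num.sqrt (f u)) _ :=
  is_deriveZ 2 (is_derive1_sqrt_comp ft_gt0 d1f).
have r2_neq0 : 2 * Num.sqrt (f t) != 0 by rewrite mulf_neq0.
(* The closed form is written as a product with an inverse, to match [is_deriveM] and
   [is_deriveV]. *)
apply: (@near_eq_is_derive _ _ _
  (fun u => f^`()%classic u * (2 * Num.sqrt (f u))^-1)).
  near=> u; have [fu_gt0 /derivableP d1fu] : 0 < f u /\ derivable f u 1.
    by near: u.
  have dru := is_derive1_sqrt_comp fu_gt0 d1fu.
  by rewrite [RHS]derive1E derive_val derive1E.
have dq := is_deriveM d2f
  (@is_deriveV _ (fun u => 2 * Num.sqrt (f u)) _ _ _ r2_neq0 dr).
apply: (is_derive_eq dq).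
rewrite -!derive1E /GRing.scale /=.
by field.
Unshelve. all: by end_near. Qed.

Theorem theorem1 (R : realType) (I : set R) (s : R -> R) :
  open I ->
  painleve4 I s ->
  (forall t, I t -> 0 < s t) ->
  painleve4_half I (fun t => Num.sqrt (s t)).
Proof.
move=> oI [ds eqs] s_gt0.
have near_s t : I t -> \forall u \near t, 0 < s u /\ derivable s u 1.
  move=> It; have := open_nbhs_nbhs (conj oI It).
  by apply: filterS => u Iu; split; [exact: s_gt0 | have [] := ds u Iu].
have d2s t (It : I t) := is_derive1_sqrt_comp2 (near_s t It) (ds t It).2.
split=> t It.
  split; last by case: (d2s t It).
  have [/derivableP d1 _] := ds t It.
  by case: (is_derive1_sqrt_comp (s_gt0 t It) d1).
have [r [rE _] s2E] := eqs t It.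
have st_gt0 := s_gt0 t It.
have rt_neq0 : Num.sqrt (s t) != 0 by rewrite gt_eqF ?sqrtr_gt0.
have stE : s t = Num.sqrt (s t) ^+ 2 by rewrite sqr_sqrtr// ltW.
have d2 := d2s t It.
(* As [s t] is nonzero, [rE] makes [r] the actual quotient [s'^2 / (2 s)]. *)
rewrite [_^`(2)%classic t]derive1E derive_val s2E rE ?gt_eqF//.
(* With [s t] replaced by [y ^+ 2], the goal is a rational identity in [y], [t] and [s' t], in which
   the terms [s'^2 / (4 y^3)] cancel. *)
move: stE rt_neq0; set y := Num.sqrt _ => -> y_neq0.
by field.
Qed.
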